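(* Let $H$ be a real Hilbert space and let $A,B:H\rightrightarrows H$ be two maximal monotone operators such that the sets $C=B^{-1}(0)$ and $(A+N_C)^{-1}(0)$ are nonempty. Assume that the operator $A+N_C$ is maximal monotone. Given a map $\beta:[0,+\infty[\to\,]0,+\infty[$, assume that the operator $A+\beta(t)B$ is maximal monotone for every $t\ge0$. Suppose additionally that $$\forall z\in C,\ \forall q\in N_C(z),\qquad \int_0^{+\infty}\beta(t)\,G_B\!\left(z,\frac{q}{\beta(t)}\right)dt<+\infty .$$ Then every strong global solution $x(\cdot)$ of $$\dot x(t)+A(x(t))+\beta(t)\,B(x(t))\ni 0$$ converges weakly in average to some $x_\infty\in(A+N_C)^{-1}(0)$, i.e. $\frac1t\int_0^t x(s)\,ds\rightharpoonup x_\infty$ weakly in $H$ as $t\to+\infty$.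
   Context: $H$ is a real Hilbert space with scalar product $\langle\cdot,\cdot\rangle$. A multivalued operator $M:H\rightrightarrows H$ assigns to each $x\in H$ a set $Mx\subset H$; $\mathrm{gph}\,M=\{(x,u): u\in Mx\}$, $M^{-1}(0)=\{x:0\in Mx\}$. $M$ is monotone if $\langle y-x,v-u\rangle\ge0$ for all $(x,u),(y,v)\in\mathrm{gph}\,M$, and maximal monotone if no monotone operator has a graph strictly containing $\mathrm{gph}\,M$. Sums and positive multiples are pointwise: $(A+\lambda B)(x)=\{a+\lambda b: a\in Ax,\ b\in Bx\}$. The Brézis–Haraux function of $M$ is $G_M(x,u)=\sup_{(y,v)\in\mathrm{gph}\,M}\langle x-y,v-u\rangle$. For a nonempty convex set $C\subset H$ and $x\in C$, $N_C(x)=\{p\in H:\langle p,y-x\rangle\le0\ \forall y\in C\}$ is the normal cone, with $N_C(x)=\emptyset$ for $x\notin C$. A strong global solution is a function $x:[0,+\infty[\to H$, absolutely continuous on every bounded interval $[0,T]$, satisfying the inclusion for almost every $t>0$. *)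

(* Defs.v *)
From HB Require Import structures.
From mathcomp Require Import all_boot all_order all_algebra.
From mathcomp Require Import all_classical all_reals all_analysis.
Set Implicit Arguments.
Unset Strict Implicit.
Unset Printing Implicit Defensive.
Import Order.TTheory GRing.Theory Num.Theory.
Import numFieldNormedType.Exports.
Local Open Scope classical_set_scope.
Local Open Scope ring_scope.

(* A real Hilbert space is a complete normed space [H] together with a
   positive definite symmetric bilinear form [dot : {dot H for idfun}]
   satisfying [inner_norm]; only the underlying function of [dot] matters
   in the definitions below. *)
Definition inner_norm (R : realType) (H : normedModType R)
    (dot : H -> H -> R) : Prop :=
  forall u : H, dot u u = `|u| ^+ 2.

Definition operator (R : realType) (H : normedModType R) := H -> set H.

Section Operators.
Context {R : realType} {H : normedModType R}.
Implicit Types (dot : H -> H -> R) (M N : operator H) (C : set H).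

Definition gph M : set (H * H) := [set p | M p.1 p.2].

Definition zeros M : set H := [set x | M x 0].

Definition op_add M N : operator H :=
  fun x => [set a + b | a in M x & b in N x].

Definition op_scale (l : R) M : operator H :=
  fun x => [set l *: b | b in M x].

Definition monotone_op dot M : Prop :=
  forall p q, gph M p -> gph M q -> 0 <= dot (q.1 - p.1) (q.2 - p.2).

Definition maximal_monotone dot M : Prop :=
  monotone_op dot M /\ ~ exists N, monotone_op dot N /\ gph M `<` gph N.

Definition normal_cone dot C : operator H :=
  fun x => [set p | C x /\ forall y, C y -> dot p (y - x) <= 0].

Definition brezis_haraux dot M (x u : H) : \bar R :=
  ereal_sup [set (dot (x - p.1) (p.2 - u))%:E | p in gph M].

Definition weakly_cvg dot (T : Type) (F : set_system T) (f : T -> H) (l : H)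
    : Prop :=
  forall h : H, (fun t => dot (f t) h) @ F --> dot l h.

Definition abs_continuous (a b : R) (x : R -> H) : Prop :=
  forall e : R, 0 < e -> exists2 d : R, 0 < d &
    forall (n : nat) (u v : 'I_n -> R),
      (forall i, a <= u i /\ u i <= v i /\ v i <= b) ->
      trivIset [set: 'I_n] (fun i => `]u i, v i[%classic) ->
      \sum_(i < n) (v i - u i) < d ->
      \sum_(i < n) `|x (v i) - x (u i)| < e.

(* Only the values of [beta] and [x] on [0, +oo[ are relevant: derivability at
   some [t > 0] is a local property. *)
Definition strong_global_solution (A B : operator H) (beta : R -> R)
    (x : R -> H) : Prop :=
  (forall T : R, 0 <= T -> abs_continuous 0 T x) /\
  {ae @lebesgue_measure R, forall t : R, 0 < t ->
    derivable x t 1 /\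
    exists a b : H, [/\ A (x t) a, B (x t) b &
      derive1 x t + a + beta t *: b = 0]}.

End Operators.

Section Bochner.
Context {d : measure_display} {T : measurableType d} {R : realType}
  {H : normedModType R}.
Variables (mu : {measure set T -> \bar R}) (D : set T).

Record step_function := StepFunction {
  step_size : nat;
  step_set : 'I_step_size -> set T;
  step_val : 'I_step_size -> H;
  step_measurable : forall i, measurable (step_set i);
  step_sub : forall i, step_set i `<=` D;
  step_finite : forall i, (mu (step_set i) < +oo)%E }.

Definition step_eval (s : step_function) (t : T) : H :=
  \sum_(i < step_size s) (\1_(step_set i) t : R) *: step_val i.

Definition step_integral (s : step_function) : H :=
  \sum_(i < step_size s) fine (mu (step_set i)) *: step_val i.

Definition is_bochner_integral (f : T -> H) (I : H) : Prop :=
  exists s : nat -> step_function,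
    [/\ {ae mu, forall t, D t -> (fun n => step_eval (s n) t) @ \oo --> f t},
        (fun n => \int[mu]_(t in D) (`|f t - step_eval (s n) t|)%:E)%E
          @ \oo --> 0%E
      & (fun n => step_integral (s n)) @ \oo --> I].

(* The value is [0] when [f] is not Bochner integrable on [D]. *)
Definition bochner_integral (f : T -> H) : H :=
  xget 0 [set I | is_bochner_integral f I].

End Bochner.

Definition time_average (R : realType) (H : normedModType R) (x : R -> H)
    (t : R) : H :=
  t^-1 *: bochner_integral (@lebesgue_measure R) `[0, t]%classic x.

(* Main.v *)
Require Import Defs.
From mathcomp Require Import all_boot all_order all_algebra.
From mathcomp Require Import all_classical all_reals all_analysis.
From mathcomp Require Import measurable_realfun ring lra.
Import Order.TTheory GRing.Theory Num.Theory.
Import numFieldNormedType.Exports.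
Local Open Scope classical_set_scope.
Local Open Scope ring_scope.

(** Let [u] be a point of the domain of [A + N_C] and [w = a + q] with [a] in
    [A u] and [q] in [N_C u].  Write a solution as
    [x' = - a' - beta t *: b'] with [a'] in [A (x t)] and [b'] in [B (x t)].
    Monotonicity of [A] disposes of [a'], and the Brezis-Haraux function, being
    a supremum over the graph of [B], bounds what involves [b']: for almost
    every [t]
      [d/dt (1/2 |x t - u|^2) + <x t - u, w> <= beta t * G_B (u, q / beta t)]
    ([energy_rate_le]).  The right-hand side is nonnegative with finite
    integral over the half-line, so [1/2 |x t - u|^2 + int_0^t <x - u, w>] has
    increments dominated by those of a bounded nondecreasing function
    ([energy_increments]).  This is used twice.

    With [w = 0]: [|x t - u|] has a limit for every zero [u] of [A + N_C]; in
    particular the solution is bounded.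

    With [w] arbitrary: dividing by [t], the time average [X t] satisfies
    [<X t - u, w> <= C / t].  A weak cluster point [l] of [X] therefore
    satisfies [<l - u, w> <= 0] on the whole graph of [A + N_C], and maximality
    makes it a zero of [A + N_C] ([weak_limit_zero]).

    Two weak cluster points [l] and [l'] are then both zeros, so
    [|x t - l|^2 - |x t - l'|^2] converges, hence so does [<x t, l - l'>].  By
    Cesaro its averages have the same limit, which is thus equal to both
    [<l, l - l'>] and [<l', l - l'>]; hence [l = l'] and [X] converges weakly
    ([opial_time_average]).  Weak compactness of bounded sets is exploited along
    ultrafilters: each bounded scalar function [<X t, h>] has a limit, and the
    Riesz representation theorem turns these limits into a vector.

    Two analytic facts support this.  The differential inequality holds only
    almost everywhere, and is integrated by [growth_le_of_ae_slope_le], which is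
    the half of the fundamental theorem of calculus for absolutely continuous
    functions that inequalities require.  The Bochner integral defining [X t] is
    computed by testing it against vectors ([dot_bochner_integral]), and its
    existence for continuous integrands again rests on Riesz's theorem
    ([exists_bochner_integral]). *)

(** * Real Hilbert spaces: Riesz representation and weak compactness *)

Section Hilbert.
Context {R : realType} {H : completeNormedModType R} {dot : {dot H for idfun}}.
Context (hdot : inner_norm dot).

Lemma dotC u v : dot u v = dot v u.
Proof. by rewrite hermC /= expr0 mul1r. Qed.

Lemma dotDl u v w : dot (u + v) w = dot u w + dot v w.
Proof. exact: linearDl. Qed.

Lemma dotDr u v w : dot w (u + v) = dot w u + dot w v.
Proof. exact: linearDr. Qed.

Lemma dotBl u v w : dot (u - v) w = dot u w - dot v w.
Proof. exact: linearBl. Qed.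

Lemma dotBr u v w : dot w (u - v) = dot w u - dot w v.
Proof. exact: linearBr. Qed.

Lemma dotZl a u v : dot (a *: u) v = a * dot u v.
Proof. exact: linearZl_LR. Qed.

Lemma dotZr a u v : dot u (a *: v) = a * dot u v.
Proof. by rewrite dotC dotZl dotC. Qed.

Lemma dot0l u : dot 0 u = 0.
Proof. exact: linear0l. Qed.

Lemma dot0r u : dot u 0 = 0.
Proof. exact: linear0r. Qed.

Lemma dotNr u v : dot u (- v) = - dot u v.
Proof. exact: linearNr. Qed.

Lemma dot_ge0 u : 0 <= dot u u.
Proof. by rewrite hdot exprn_ge0. Qed.

Lemma dot_eq0 u : dot u u = 0 -> u = 0.
Proof. by rewrite hdot => /eqP; rewrite sqrf_eq0 normr_eq0 => /eqP. Qed.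

Lemma norm_dot_le u v : `|dot u v| <= `|u| * `|v|.
Proof.
have [->|v0] := eqVneq v 0; first by rewrite dot0r !normr0 mulr0.
have vv : 0 < dot v v by rewrite hdot exprn_gt0// normr_gt0.
(* [dot v v] times the component of [u] orthogonal to [v] *)
have := dot_ge0 (dot v v *: u - dot u v *: v).
rewrite !(dotBl, dotBr, dotZl, dotZr) (dotC v u) => h.
have {}h : 0 <= dot v v * (dot v v * dot u u - dot u v ^+ 2) by nra.
have {}h : 0 <= dot v v * dot u u - dot u v ^+ 2 by rewrite pmulr_rge0 in h.
rewrite -(@ler_pXn2r _ 2)// ?nnegrE ?mulr_ge0// exprMn real_normK ?num_real//.
by rewrite -!hdot; lra.
Qed.

Lemma cvg_dot {T : Type} (F : set_system T) {FF : Filter F} (f g : T -> H) a b :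
  f @ F --> a -> g @ F --> b -> (fun t => dot (f t) (g t)) @ F --> dot a b.
Proof.
move=> fa gb; apply: cvg_zero; apply/norm_cvg0P.
apply: (@squeeze_cvgr _ _ _ _ (fun=> 0)
  (fun t => `|f t - a| * `|g t| + `|a| * `|g t - b|)).
- apply: nearW => t; rewrite normr_ge0 /= !fctE.
  have -> : dot (f t) (g t) - cst (dot a b) t =
      dot (f t - a) (g t) + dot a (g t - b) by rewrite dotBl dotBr /cst; ring.
  by rewrite (le_trans (ler_normD _ _))// lerD ?norm_dot_le.
- exact: cvg_cst.
- have fa0 : `|f t - a| @[t --> F] --> 0.
    by apply/norm_cvg0P; rewrite -(subrr a); apply: cvgB => //; exact: cvg_cst.
  have gb0 : `|g t - b| @[t --> F] --> 0.
    by apply/norm_cvg0P; rewrite -(subrr b); apply: cvgB => //; exact: cvg_cst.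
  rewrite -[X in _ --> X](_ : 0 * `|b| + `|a| * 0 = 0); last first.
    by rewrite mul0r mulr0 addr0.
  apply: cvgD; apply: cvgM => //; [exact: cvg_norm|exact: cvg_cst].
Qed.

(** The representing vector minimizes [|u|^2 - 2 L u]: the parallelogram
    identity makes every minimizing sequence Cauchy, and the first-order
    condition at the minimum is the representation. *)
Lemma riesz (L : H -> R) (M : R) :
  (forall a u v, L (a *: u + v) = a * L u + L v) ->
  (forall u, `|L u| <= M * `|u|) ->
  exists v, forall u, L u = dot v u.
Proof.
move=> Llin Lbd.
have L0 : L 0 = 0.
  by apply/eqP; rewrite -normr_le0 (le_trans (Lbd 0))// normr0 mulr0.
have LZ a u : L (a *: u) = a * L u by rewrite -[a *: u]addr0 Llin L0 addr0.
have LD u v : L (u + v) = L u + L v by rewrite -[u]scale1r Llin mul1r scale1r.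
pose J u := dot u u - 2 * L u.
have J_lb u : - M ^+ 2 <= J u.
  have := Lbd u; rewrite ler_norml => /andP[_ h].
  rewrite /J hdot; have := sqr_ge0 (`|u| - M); nra.
have hasJ : has_inf (range J).
  split; first by exists (J 0), 0.
  by exists (- M ^+ 2) => _ [u _ <-].
pose m := inf (range J).
have mJ u : m <= J u by apply: (ge_inf hasJ.2); exists u.
have /choice[v vJ] : forall n : nat, exists v, J v < m + n.+1%:R^-1.
  move=> n; have [|_ [v _ <-] h] := @inf_adherent _ (range J) n.+1%:R^-1 _ hasJ.
    by rewrite invr_gt0.
  by exists v.
have parallelogram a b : `|a - b| ^+ 2 <= 2 * (J a - m) + 2 * (J b - m).
  have := mJ (2^-1 *: (a + b)).
  rewrite -hdot /J LZ LD !(dotBl, dotBr, dotZl, dotZr, dotDl, dotDr) (dotC b a).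
  lra.
have [l vl] : exists l : H, v n @[n --> \oo] --> l.
  apply/cvg_ex; apply: cauchy_cvg; apply: cauchy_exP => e e0.
  have e4 : 0 < e ^+ 2 / 4 by rewrite divr_gt0 ?exprn_gt0.
  near \oo => N.
  exists (v N); change (\forall n \near \oo, ball (v N) e (v n)).
  near=> n.
  rewrite -ball_normE /ball_/= -(@ltr_pXn2r _ 2)// ?nnegrE// ?(ltW e0)//.
  apply: le_lt_trans (parallelogram _ _) _.
  have vN : J (v N) < m + e ^+ 2 / 4.
    apply: lt_le_trans (vJ N) _; rewrite lerD2l.
    by apply/ltW; near: N; exact: (near_infty_natSinv_lt (PosNum e4)).
  have vn : J (v n) < m + e ^+ 2 / 4.
    apply: lt_le_trans (vJ n) _; rewrite lerD2l.
    by apply/ltW; near: n; exact: (near_infty_natSinv_lt (PosNum e4)).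
  lra.
have Ll : L (v n) @[n --> \oo] --> L l.
  apply: cvg_zero; apply/norm_cvg0P.
  apply: (@squeeze_cvgr _ _ _ _ (fun=> 0) (fun n => M * `|v n - l|)).
  - apply: nearW => n; rewrite normr_ge0 /= !fctE /cst.
    by have := Lbd (v n - l); rewrite LD -scaleN1r LZ mulN1r.
  - exact: cvg_cst.
  - rewrite -(mulr0 M); apply: cvgM; first exact: cvg_cst.
    by apply/norm_cvg0P; rewrite -(subrr l); apply: cvgB => //; exact: cvg_cst.
have Jl : J l <= m.
  have JvJ : J (v n) @[n --> \oo] --> J l.
    apply: cvgB; first exact: cvg_dot.
    by apply: cvgM => //; exact: cvg_cst.
  have : (m + n.+1%:R^-1) @[n --> \oo] --> m + 0.
    by apply: cvgD; [exact: cvg_cst|exact: cvg_harmonic].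
  rewrite addr0 => hm.
  by apply: (ler_cvg_to JvJ hm); apply: nearW => n; apply/ltW/vJ.
exists l => u.
have quad s : 0 <= s ^+ 2 * dot u u + 2 * s * (dot l u - L u).
  have := le_trans Jl (mJ (l + s *: u)).
  rewrite /J LD LZ !(dotDl, dotDr, dotZl, dotZr) (dotC u l); nra.
have := dot_ge0 u; rewrite le_eqVlt => /predU1P[/esym/dot_eq0->|u0].
  by rewrite L0 dot0r.
(* the minimizer of the quadratic polynomial in [s] *)
have := quad (- (dot l u - L u) / dot u u).
set c := dot l u - L u => h.
suff : c = 0 by rewrite /c; lra.
apply/eqP; rewrite -sqrf_eq0 eq_le sqr_ge0 andbT.
have {}h : 0 <= - (c ^+ 2 / dot u u).
  apply: le_trans h _; rewrite le_eqVlt; apply/orP; left; apply/eqP.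
  by field; rewrite gt_eqF.
by move: h; rewrite oppr_ge0 pmulr_lle0 ?invr_gt0.
Unshelve. all: by end_near. Qed.

Lemma ultra_bounded_cvg {T : Type} {U : set_system T} {UU : UltraFilter U}
    (f : T -> R) (M : R) :
  (\forall t \near U, `|f t| <= M) ->
  exists2 c, f t @[t --> U] --> c & `|c| <= M.
Proof.
move=> fM; have UP := @ultra_proper _ _ UU.
have [|c [cM cl]] := @segment_compact R (- M) M (f t @[t --> U]) _.
  by apply: filterS fM => t /=; rewrite in_itv/= ler_norml.
exists c; last by move: cM; rewrite /= in_itv/= ler_norml.
move=> V cV /=; have [//|UV] := in_ultra_setVsetC (f @^-1` V) UU.
by have [y []] := cl (~` V : set R) V UV cV.
Qed.

(** Otherwise some neighbourhood [V] of [c] has a preimage outside [F], and an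
    ultrafilter containing [F] and the complement of that preimage would
    contradict the hypothesis. *)
Lemma cvg_ultra {T : Type} {S : topologicalType} {F : set_system T}
    {FF : ProperFilter F} (f : T -> S) (c : S) :
  (forall U, UltraFilter U -> F `<=` U -> f t @[t --> U] --> c) ->
  f t @[t --> F] --> c.
Proof.
move=> fc V cV; apply: contrapT => nFV.
have GP : ProperFilter (within (~` (f @^-1` V)) F).
  apply: Build_ProperFilter_ex => P; rewrite /within /= => FP.
  apply: contrapT => nP; apply: nFV; apply: filterS FP => t Pt.
  by apply: contrapT => nV; apply: nP; exists t; exact: Pt.
have [U [UU GU]] := ultraFilterLemma GP.
have UV : U (f @^-1` V).
  by apply: (fc U UU) cV => P FP; apply: GU; apply: filterS FP => t Pt _.
have UnV : U (~` (f @^-1` V)).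
  by apply: GU; apply: filterS (@filterT _ F _) => t _.
have UP := @ultra_proper _ _ UU.
by have [t []] := filter_ex (filterI UV UnV).
Qed.

(** Weak compactness of balls, phrased with ultrafilters: the limits of
    [dot (f t) h] along [U] form a bounded linear functional of [h]. *)
Lemma weakly_cvg_ultra {T : Type} {U : set_system T} {UU : UltraFilter U}
    (f : T -> H) (M : R) :
  (\forall t \near U, `|f t| <= M) -> exists l, weakly_cvg dot U f l.
Proof.
move=> fM; have UP := @ultra_proper _ _ UU.
have /choice[L hL] : forall h, exists c,
    dot (f t) h @[t --> U] --> c /\ `|c| <= M * `|h|.
  move=> h.
  have [|c] := @ultra_bounded_cvg T U _ (fun t => dot (f t) h) (M * `|h|).
    apply: filterS fM => t tM.
    by rewrite (le_trans (norm_dot_le _ _))// ler_wpM2r.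
  by exists c.
have [|h|l Ll] := @riesz L M _ _;
  last by exists l => h; rewrite -Ll; case: (hL h).
- move=> a u v; apply: (cvg_unique _ (hL (a *: u + v)).1) => //.
  rewrite /=; under eq_fun do rewrite dotDr dotZr.
  apply: cvgD; last exact: (hL v).1.
  by apply: cvgM; [exact: cvg_cst|exact: (hL u).1].
- by case: (hL h).
Qed.

End Hilbert.

(** * Growth of absolutely continuous functions *)

Section Growth.
Context {R : realType}.
Notation mu := (@lebesgue_measure R).

Lemma sum_length_disjoint_itv {n : nat} (u v : 'I_n -> R) (U : set R) :
  measurable U -> (forall i, u i <= v i) ->
  (forall i, `]u i, v i[%classic `<=` U) ->
  trivIset [set: 'I_n] (fun i => `]u i, v i[%classic) ->
  ((\sum_(i < n) (v i - u i))%:E <= mu U)%E.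
Proof.
move=> mU uv uvU tuv.
have -> : (\sum_(i < n) (v i - u i))%:E =
    mu (\big[setU/set0]_(i < n) `]u i, v i[%classic).
  rewrite (measure_bigsetU_ord mu xpredT)//.
  rewrite -sumEFin; apply: eq_bigr => i _.
  rewrite /= lebesgue_measure_itv/= lte_fin; case: ltP => //= h.
  by rewrite (@le_anti _ _ (u i) (v i)) ?subrr// h uv.
apply: le_measure; rewrite ?inE//.
  by apply: bigsetU_measurable => i _; exact: measurable_itv.
apply: (big_ind (fun A => A `<=` U)) => [//|A B AU BU t []|i _].
- exact: AU.
- exact: BU.
- exact: uvU.
Qed.

(** The possible values of the variation of [F] over finite families of
    disjoint intervals inside [U] and between [a] and [r]; its supremum measures
    how much [F] can change on [U] before [r]. *)
Definition jump_sums (F : R -> R) (U : set R) (a r : R) : set R :=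
  [set s | exists n (u v : 'I_n -> R),
    [/\ forall i, [/\ a <= u i, u i <= v i & v i <= r],
        forall i, `]u i, v i[%classic `<=` U,
        trivIset [set: 'I_n] (fun i => `]u i, v i[%classic)
      & s = \sum_(i < n) `|F (v i) - F (u i)| ]].

Lemma jump_sums0 F U a r : jump_sums F U a r 0.
Proof.
exists 0%N, (fun=> 0), (fun=> 0); split; [by case|by case| |].
  by move=> [].
by rewrite big_ord0.
Qed.

Lemma jump_sumsS F U a r r' : r <= r' ->
  jump_sums F U a r `<=` jump_sums F U a r'.
Proof.
move=> rr' _ [n [u [v [auv uvU tuv ->]]]]; exists n, u, v; split => // i.
by have [? ? vr] := auv i; split => //; exact: le_trans rr'.
Qed.

(** The new interval receives index [ord0], the old ones being shifted by
    [lift ord0]. *)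
Lemma jump_sums_step F U a r r' s : a <= r -> r <= r' ->
  `]r, r'[%classic `<=` U -> jump_sums F U a r s ->
  jump_sums F U a r' (s + `|F r' - F r|).
Proof.
move=> ar rr' rU [n [u [v [auv uvU tuv ->]]]].
pose u' (i : 'I_n.+1) := oapp u r (unlift ord0 i).
pose v' (i : 'I_n.+1) := oapp v r' (unlift ord0 i).
have u'0 : u' ord0 = r by rewrite /u' unlift_none.
have v'0 : v' ord0 = r' by rewrite /v' unlift_none.
have u'S i : u' (lift ord0 i) = u i by rewrite /u' liftK.
have v'S i : v' (lift ord0 i) = v i by rewrite /v' liftK.
exists n.+1, u', v'; split.
- move=> i; case: (unliftP ord0 i) => [j|] ->.
    rewrite u'S v'S; have [? ? vr] := auv j; split => //.
    exact: le_trans rr'.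
  by rewrite u'0 v'0.
- move=> i; case: (unliftP ord0 i) => [j|] ->.
    by rewrite u'S v'S.
  by rewrite u'0 v'0.
- move=> i j _ _.
  case: (unliftP ord0 i) => [i'|] ->; case: (unliftP ord0 j) => [j'|] ->.
  + by rewrite !u'S !v'S => h; congr lift; exact: tuv.
  + rewrite u'S v'S u'0 v'0 => -[t []] /=; rewrite !in_itv/=.
    move=> /andP[_ tv] /andP[rt _].
    have [_ _ vr] := auv i'.
    by move: (lt_le_trans tv vr); rewrite ltNge (ltW rt).
  + rewrite u'S v'S u'0 v'0 => -[t []] /=; rewrite !in_itv/=.
    move=> /andP[rt _] /andP[_ tv].
    have [_ _ vr] := auv j'.
    by move: (lt_le_trans tv vr); rewrite ltNge (ltW rt).
  + by [].
- rewrite big_ord_recl u'0 v'0 addrC; congr (_ + _).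
  by apply: eq_bigr => i _; rewrite u'S v'S.
Qed.

(** An absolutely continuous function whose right slopes are, off a null set
    [N], at most those of a nondecreasing [Phi] grows no more than [Phi].  Cover
    [N] by an open set [U] so small that the variation [V] of [F] on [U] is at
    most [e]; then [F r - F a <= Phi r - Phi a + e (r - a) + V r] propagates
    from left to right, a point outside [N] using its slope and a point of [N]
    the growth of [V].  Limits from the left are reached by continuity of [F]
    and monotonicity of [Phi] and [V]. *)
Lemma growth_le_of_ae_slope_le (F Phi : R -> R) (a b : R) (N : set R) :
  a <= b -> abs_continuous a b F -> mu.-negligible N ->
  {in `[a, b] &, {homo Phi : s t / s <= t}} ->
  (forall t, a <= t -> t < b -> ~ N t -> forall e, 0 < e ->
     \forall r \near t^'+, F r - F t <= Phi r - Phi t + e * (r - t)) ->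
  F b - F a <= Phi b - Phi a.
Proof.
move=> ab acF [N' [mN' N'0 NN']] Phimono slope.
suff main e : 0 < e -> F b - F a <= Phi b - Phi a + e * (b - a) + e.
  apply/ler_addgt0Pl => e e0.
  have e'0 : 0 < e / (b - a + 1) by rewrite divr_gt0// ltr_wpDl ?subr_ge0.
  apply: le_trans (main _ e'0) _.
  rewrite -addrA -[X in _ + (_ + X)]mulr1 -mulrDr addrC.
  by rewrite divfK// gt_eqF// ltr_wpDl ?subr_ge0.
move=> e0.
have [d d0 acd] := acF e e0.
have [U [oU NU mUd]] : exists U : set R,
    [/\ open U, N `<=` U & (mu U < d%:E)%E].
  have [|U [oU N'U mU]] := @lebesgue_regularity_outer R N' d mN' _ d0.
    by rewrite [X in (X < _)%E](_ : _ = 0%E)//; exact: N'0.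
  exists U; split => //; first exact: subset_trans N'U.
  apply: le_lt_trans mU.
  have {1}-> : U = N' `|` (U `\` N') by rewrite setDUK.
  have mUN : measurable (U `\` N').
    by apply: measurableD => //; exact: open_measurable.
  apply: le_trans (measureU2 _ mN' mUN) _.
  by rewrite [X in (X + _)%E](_ : _ = 0%E) ?add0e//; exact: N'0.
have jump_lt r s : r <= b -> jump_sums F U a r s -> s < e.
  move=> rb [n [u [v [auv uvU tuv ->]]]]; apply: acd => //.
    move=> i; have [? ? vr] := auv i; split => //.
    by split=> //; exact: le_trans rb.
  rewrite -lte_fin; apply: le_lt_trans mUd.
  apply: sum_length_disjoint_itv => //; first exact: open_measurable.
  by move=> i; have [] := auv i.
pose V r := sup (jump_sums F U a r).
have hasV r : r <= b -> has_sup (jump_sums F U a r).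
  move=> rb; split; first by exists 0; exact: jump_sums0.
  by exists e => s /(jump_lt r s rb)/ltW.
have Ve r : r <= b -> V r <= e.
  move=> rb; apply: ge_sup; first exact: (hasV r rb).1.
  by move=> s /(jump_lt r s rb)/ltW.
have V0 : 0 <= V a by apply: (ub_le_sup (hasV a ab).2); exact: jump_sums0.
have VS r r' : r <= r' -> r' <= b -> V r <= V r'.
  move=> rr' r'b; apply: le_sup.
  - by move=> s ?; exists s; split => //; exact: (jump_sumsS _ _ _ _ _ rr').
  - exact: (hasV r (le_trans rr' r'b)).1.
  - exact: hasV.
have Vstep r r' : a <= r -> r <= r' -> r' <= b -> `]r, r'[%classic `<=` U ->
    V r + `|F r' - F r| <= V r'.
  move=> ar rr' r'b rU; rewrite -lerBrDr; apply: ge_sup.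
    exact: (hasV r (le_trans rr' r'b)).1.
  move=> s js; rewrite lerBrDr; apply: (ub_le_sup (hasV r' r'b).2).
  exact: jump_sums_step.
pose good r := F r - F a <= Phi r - Phi a + e * (r - a) + V r.
suff gb : good b by apply: le_trans gb _; rewrite lerD2l; exact: Ve.
pose S := [set r | a <= r <= b /\ good r].
have Sa : S a by split; rewrite ?lexx// /good !subrr mulr0 !add0r.
have hasS : has_sup S by split; [exists a|exists b => r [/andP[]]].
pose c := sup S.
have ac : a <= c by apply: (ub_le_sup hasS.2).
have cb : c <= b by apply: ge_sup; [exists a|move=> r [/andP[]]].
have abP t : a <= t -> t <= b -> t \in `[a, b].
  by move=> *; rewrite in_itv/=; apply/andP.
have gc : good c.
  (* [eta] absorbs the small change of [F] between [c] and a good [r] below *)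
  apply/ler_addgt0Pl => eta eta0; rewrite addrC.
  have [dd dd0 acdd] := acF eta eta0.
  have [r [/andP[ar rb] gr] rc] := sup_adherent dd0 hasS.
  have rlec : r <= c by apply: (ub_le_sup hasS.2); split => //; apply/andP.
  have : `|F c - F r| < eta.
    have := acdd 1%N (fun=> r) (fun=> c); rewrite !big_ord1; apply => //.
    - by move=> i j _ _ _; rewrite (ord1 i) (ord1 j).
    - by rewrite ltrBlDl addrC -ltrBlDl.
  move=> /(le_lt_trans (ler_norm _)) Fcr.
  have := Phimono r c (abP _ ar rb) (abP _ ac cb) rlec.
  have := VS r c rlec cb.
  have := ler_wpM2l (ltW e0) rlec.
  by move: gr; rewrite /good; nra.
have [<-//|] := eqVneq c b.
move=> bc; have {bc}cb' : c < b by rewrite lt_neqAle bc cb.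
suff [r [cr rb gr]] : exists r, [/\ c < r, r <= b & good r].
  have : r <= c.
    apply: (ub_le_sup hasS.2); split => //.
    by rewrite rb (le_trans ac (ltW cr)).
  by rewrite leNgt cr.
have [Nc|nNc] := pselect (N c).
- have [dd /= dd0 ball_U] : nbhs_ball c U.
    by rewrite nbhs_ballE; apply: open_nbhs_nbhs; split => //; exact: NU.
  pose r := Num.min b (c + dd / 2).
  have cr : c < r by rewrite lt_min cb' ltrDl divr_gt0.
  have rb : r <= b by rewrite ge_min lexx.
  exists r; split => //.
  have rU : `]c, r[%classic `<=` U.
    move=> t /=; rewrite in_itv/= => /andP[ct]; rewrite lt_min => /andP[_ td].
    apply: ball_U; rewrite -ball_normE /ball_/= distrC gtr0_norm ?subr_gt0//.
    rewrite ltrBlDl (lt_trans td)// ltrD2l ltr_pdivrMr//.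
    by rewrite mulr_natr mulr2n ltrDl.
  have := Vstep c r ac (ltW cr) rb rU.
  have := Phimono c r (abP _ ac cb) (abP _ (le_trans ac (ltW cr)) rb) (ltW cr).
  have := ler_wpM2l (ltW e0) (ltW cr).
  have := ler_norm (F r - F c).
  by move: gc; rewrite /good; nra.
- have hr := slope c ac cb' nNc e e0.
  near c^'+ => r.
  have cr : c < r by near: r; exact: nbhs_right_gt.
  have rb : r <= b by near: r; exact: nbhs_right_le.
  exists r; split => //.
  have : F r - F c <= Phi r - Phi c + e * (r - c) by near: r.
  have := VS c r (ltW cr) rb.
  by move: gc; rewrite /good; nra.
Unshelve. all: by end_near. Qed.

End Growth.

Section AbsContinuity.
Context {R : realType}.
Notation mu := (@lebesgue_measure R).

Lemma abs_continuousS {H : normedModType R} {a b a' b' : R} {x : R -> H} :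
  a <= a' -> b' <= b -> abs_continuous a b x -> abs_continuous a' b' x.
Proof.
move=> aa' b'b acx e e0; have [d d0 acd] := acx e e0.
exists d => // n u v uv; apply: acd => i; have [au [? vb]] := uv i.
by split; [exact: le_trans au|split => //; exact: le_trans b'b].
Qed.

Lemma abs_continuous_unif {H : normedModType R} {a b : R} {x : R -> H} :
  abs_continuous a b x -> forall e, 0 < e -> exists2 d, 0 < d &
    forall u v, a <= u -> u <= b -> a <= v -> v <= b -> `|u - v| < d ->
      `|x u - x v| < e.
Proof.
move=> acx e e0; have [d d0 acd] := acx e e0; exists d => //.
have main u v : a <= u -> u <= v -> v <= b -> `|u - v| < d -> `|x u - x v| < e.
  move=> au uv vb; rewrite distrC ger0_norm ?subr_ge0// => uvd.
  have := acd 1%N (fun=> u) (fun=> v); rewrite !big_ord1 distrC; apply => //.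
  by move=> i j _ _ _; rewrite (ord1 i) (ord1 j).
move=> u v au ub av vb uvd; have [uv|/ltW vu] := leP u v; first exact: main.
by rewrite distrC; apply: main => //; rewrite distrC.
Qed.

Lemma abs_continuous_id (a b : R) : abs_continuous a b (fun t : R => t : R^o).
Proof.
move=> e e0; exists e => // n u v uv _.
apply: le_lt_trans; apply: ler_sum => i _.
by have [_ [uvi _]] := uv i; rewrite ger0_norm// subr_ge0.
Qed.

(** Covers Lipschitz functions (take the identity for [x]) as well as locally
    Lipschitz functions of [x] along a bounded trajectory. *)
Lemma abs_continuous_dominated {V W : normedModType R} (a b M : R)
    (x : R -> V) (y : R -> W) :
  (forall u v, a <= u -> u <= v -> v <= b ->
    `|y v - y u| <= M * `|x v - x u|) ->
  abs_continuous a b x -> abs_continuous a b y.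
Proof.
move=> yx acx e e0.
have M0 : 0 < `|M| + 1 by rewrite ltr_wpDl.
have [d d0 acd] := acx (e / (`|M| + 1)) (divr_gt0 e0 M0).
exists d => // n u v uv tuv uvd.
have := acd n u v uv tuv uvd; rewrite ltr_pdivlMr// => lte.
apply: le_lt_trans lte.
rewrite mulr_suml; apply: ler_sum => i _; have [au [uvi vb]] := uv i.
apply: le_trans (yx _ _ au uvi vb) _; rewrite mulrC ler_wpM2l//.
by apply: le_trans (ler_norm _) _; rewrite lerDl.
Qed.

Lemma abs_continuousD {V : normedModType R} (a b : R) (x y : R -> V) :
  abs_continuous a b x -> abs_continuous a b y ->
  abs_continuous a b (fun t => x t + y t).
Proof.
move=> acx acy e e0; have e2 : 0 < e / 2 by rewrite divr_gt0.
have [d d0 acd] := acx _ e2; have [d' d'0 acd'] := acy _ e2.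
exists (Num.min d d'); first by rewrite lt_min d0.
move=> n u v uv tuv; rewrite lt_min => /andP[uvd uvd'].
rewrite [e]splitr; apply: le_lt_trans
  (ltrD (acd n u v uv tuv uvd) (acd' n u v uv tuv uvd')).
rewrite -big_split; apply: ler_sum => i _ /=.
by rewrite opprD addrACA ler_normD.
Qed.

Lemma near_right_slope_lt (G : R -> R) (t l : R) :
  derivable G t 1 -> derive1 G t < l ->
  \forall r \near t^'+, G r - G t <= l * (r - t).
Proof.
move=> dG Gl.
have : h^-1 *: (G (h *: 1 + t) - G t) @[h --> 0^'] --> derive1 G t.
  by rewrite derive1E; exact: dG.
move=> /cvgr_lt /(_ _ Gl) [d /= d0 hd].
near=> r.
have tr : t < r by near: r; exact: nbhs_right_gt.
have rd : r - t < d.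
  by rewrite ltrBlDl; near: r; apply: nbhs_right_lt; rewrite ltrDl.
have /hd : ball_ (fun x => `|x|) 0 d (r - t).
  by rewrite /ball_/= sub0r normrN gtr0_norm ?subr_gt0.
rewrite /= [(r - t) *: 1]mulr1 subrK => /(_ _)/ltW h.
rewrite -ler_pdivrMr ?subr_gt0// mulrC; apply: h.
by rewrite subr_eq0 gt_eqF.
Unshelve. all: by end_near. Qed.

Lemma le_primitive (psi : R -> R) :
  (forall t, 0 <= psi t) -> mu.-integrable setT (EFin \o psi) ->
  {homo (fun t => \int[mu]_(r in `]-oo, t]) psi r) : s t / s <= t}.
Proof.
move=> psi0 ipsi s t st; rewrite -subr_ge0.
rewrite (@Rintegral_itvB _ psi -oo%O (BRight t) s)//.
  exact: Rintegral_ge0.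
exact: integrableS ipsi.
Qed.

Lemma primitive_le_total (psi : R -> R) (t : R) :
  (forall t, 0 <= psi t) -> mu.-integrable setT (EFin \o psi) ->
  \int[mu]_(r in `]-oo, t]) psi r <= \int[mu]_r psi r.
Proof.
move=> psi0 ipsi; have E : setT = [set` `]-oo, +oo[%R] :> set R.
  by rewrite set_itvE.
rewrite -subr_ge0 E (@Rintegral_itvB _ psi -oo%O +oo%O t)//.
  exact: Rintegral_ge0.
by rewrite -E.
Qed.

(** By Lebesgue differentiation the primitive of [psi] has derivative [psi]
    almost everywhere, so it can play the part of [Phi] in
    [growth_le_of_ae_slope_le]. *)
Lemma abs_continuous_increment_le (h psi : R -> R) :
  (forall T, 0 <= T -> abs_continuous 0 T h) ->
  (forall t, 0 <= psi t) -> mu.-integrable setT (EFin \o psi) ->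
  {ae mu, forall t, 0 < t -> derivable h t 1 /\ derive1 h t <= psi t} ->
  forall s t, 0 <= s -> s <= t ->
    h t - h s <=
      \int[mu]_(r in `]-oo, t]) psi r - \int[mu]_(r in `]-oo, s]) psi r.
Proof.
move=> ach psi0 ipsi hpsi s t s0 st.
pose Phi r := \int[mu]_(w in `]-oo, r]) psi w.
have ipsiS r : mu.-integrable `]-oo, r] (EFin \o psi).
  exact: integrableS ipsi.
have Phimono : {homo Phi : a b / a <= b} by exact: le_primitive.
have lpsi : locally_integrable setT psi.
  have := @integrable_locally_restrict R psi setT measurableT ipsi.
  by rewrite patch_setT.
have FTC := FTC1Ny ipsiS lpsi.
(* 0 is put among the exceptional points as the slope is only known at positive
   times *)
have bad : mu.-negligible ([set 0] `|`
    (~` [set r | 0 < r -> derivable h r 1 /\ derive1 h r <= psi r] `|`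
     ~` [set r | derivable Phi r 1 /\ derive1 Phi r = psi r])).
  apply: negligibleU; last by apply: negligibleU; [exact: hpsi|exact: FTC].
  by apply/negligibleP => //; exact: lebesgue_measure_set1.
apply: (@growth_le_of_ae_slope_le R h Phi s t _ st _ bad).
- by apply: abs_continuousS (ach t (le_trans s0 st)).
- by move=> a b _ _; exact: Phimono.
- move=> r sr rt /not_orP[r0 /not_orP[/contrapT hr /contrapT[dPhi Phir]]] e e0.
  have {}r0 : 0 < r.
    by rewrite lt_neqAle (le_trans s0 sr) andbT eq_sym; apply/eqP.
  have [dh hpr] := hr r0.
  have : \forall q \near r^'+, (h - Phi) q - (h - Phi) r <= e * (q - r).
    apply: near_right_slope_lt; first exact: derivableB.
    rewrite derive1E deriveB// -!derive1E Phir.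
    by rewrite (le_lt_trans _ e0)// subr_le0.
  apply: filterS => q; rewrite !fctE; lra.
Qed.

(** The integral of a nonnegative function is a supremum over the simple
    functions below it, so it is monotone even on nonmeasurable functions; this
    matters because nothing makes [t |-> beta t * G_B (z, q / beta t)]
    measurable. *)
Lemma ge0_le_lower_integral {d} {T : measurableType d}
    (nu : {measure set T -> \bar R}) (D : set T) (f g : T -> \bar R) :
  (forall x, D x -> (0 <= f x)%E) -> (forall x, D x -> (f x <= g x)%E) ->
  (\int[nu]_(x in D) f x <= \int[nu]_(x in D) g x)%E.
Proof.
move=> f0 fg.
have g0 x : D x -> (0 <= g x)%E.
  by move=> Dx; apply: le_trans (fg x Dx); exact: f0.
rewrite !ge0_integralE//.
apply: le_ereal_sup => _ [k kf <-]; exists k => // x.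
apply: le_trans (kf x) _.
by rewrite /patch; case: ifPn => // /set_mem; exact: fg.
Qed.

(** Composing with [Num.max 0] extends the restriction to the half-line to a
    function that is continuous on the whole line. *)
Lemma max0_continuous {V : normedModType R} (h : R -> V) :
  (forall T, 0 <= T -> abs_continuous 0 T h) ->
  continuous (fun t : R => h (Num.max 0 t)).
Proof.
move=> ach t; apply/cvgrPdist_lt => e e0.
have T0 : 0 <= Num.max 0 t + 1 by rewrite addr_ge0// le_max lexx.
have [d d0 hd] := abs_continuous_unif (ach _ T0) e e0.
near=> r.
have r1 : `|t - r| < 1 by near: r; apply/nbhs_ballP; exists 1 => /=.
have rd : `|t - r| < d by near: r; apply/nbhs_ballP; exists d.
apply: hd; rewrite ?le_max ?lexx// ?lerDl//.
- rewrite ge_max T0/=; move: r1; rewrite ltr_distlC => /andP[_ /ltW] h1.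
  by apply: le_trans h1 _; rewrite lerD2r le_max lexx orbT.
- apply: le_lt_trans rd.
  case: (leP 0 t) => t0; case: (leP 0 r) => r0 //.
  + by rewrite subr0 ger0_norm// ger0_norm ?subr_ge0; lra.
  + by rewrite sub0r normrN ger0_norm// ler0_norm ?subr_le0; lra.
  + by rewrite subrr normr0.
Unshelve. all: by end_near. Qed.

(** [psi] is the positive part of the derivative, set to 0 on a measurable null
    set off which it is a limit of difference quotients, hence measurable.  It
    inherits the finite integral of [f] by [ge0_le_lower_integral]. *)
Lemma exists_integrable_slope (h : R -> R) (f : R -> \bar R) :
  (forall t, 0 <= t -> (0 <= f t)%E) ->
  (\int[mu]_(t in `[0%R, +oo[%classic) f t < +oo)%E ->
  (forall T, 0 <= T -> abs_continuous 0 T h) ->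
  {ae mu, forall t, 0 < t -> derivable h t 1 /\ ((derive1 h t)%:E <= f t)%E} ->
  exists psi : R -> R,
    [/\ forall t, 0 <= psi t, mu.-integrable setT (EFin \o psi) &
        {ae mu, forall t, 0 < t -> derivable h t 1 /\ derive1 h t <= psi t}].
Proof.
move=> f0 intf ach [N [mN N0 badN]].
pose g t := h (Num.max 0 t).
have cg : continuous g := max0_continuous h ach.
have gh t : 0 <= t -> g t = h t by move=> t0; rewrite /g max_r.
pose D : set R := `]0%R, +oo[%classic `\` N.
have mD : measurable D by apply: measurableD => //; exact: measurable_itv.
have D0 t : D t -> 0 < t by move=> [/=]; rewrite in_itv/= andbT.
have Dder t : D t -> derivable h t 1 /\ ((derive1 h t)%:E <= f t)%E.
  move=> Dt; apply: contrapT => nt; apply: Dt.2; apply: badN => /=.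
  by apply: contra_not nt; apply; exact: D0.
have mder : measurable_fun D (derive1 h).
  apply: (@measurable_fun_cvg _ _ R D
    (fun (n : nat) (t : R) => n.+1%:R * (g (t + n.+1%:R^-1) - g t))
    (derive1 h)).
    move=> n; apply: measurable_funTS; apply: continuous_measurable_fun.
    move=> t; apply: cvgM; first exact: cvg_cst.
    apply: cvgB; last exact: cg.
    apply: (@cvg_comp _ _ _ (fun t => t + n.+1%:R^-1) g); last exact: cg.
    by apply: cvgD; [exact: cvg_id|exact: cvg_cst].
  move=> t Dt; have t0 := D0 t Dt; have [dh _] := Dder t Dt.
  have : k^-1 *: (h (k *: 1 + t) - h t) @[k --> 0^'] --> derive1 h t.
    by rewrite derive1E; exact: dh.
  move=> /cvgrPdist_lt hd; apply/cvgrPdist_lt => e /hd [d /= d0 {}hd].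
  near=> n.
  have nd : n.+1%:R^-1 < d :> R.
    by near: n; exact: (near_infty_natSinv_lt (PosNum d0)).
  have n0 : 0 < n.+1%:R^-1 :> R by rewrite invr_gt0.
  have /hd : ball_ (fun x => `|x|) 0 d (n.+1%:R^-1 : R).
    by rewrite /ball_/= sub0r normrN gtr0_norm.
  rewrite /= [_ *: 1]mulr1 invrK gt_eqF// => /(_ isT).
  rewrite [n.+1%:R^-1 + t]addrC => hdn.
  by rewrite !gh ?addr_ge0 ?(ltW t0) ?(ltW n0).
pose psi := (fun t => Num.max 0 (derive1 h t)) \_ D.
have psi0 t : 0 <= psi t.
  by rewrite /psi /patch; case: ifP => // _; rewrite le_max lexx.
have mpsi : measurable_fun setT psi.
  apply/(measurable_restrictT _ mD); apply: measurable_maxr => //.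
exists psi; split => //.
  apply/integrableP; split; first exact/measurable_EFinP.
  apply: le_lt_trans intf.
  rewrite [leRHS]integral_mkcond.
  apply: ge0_le_lower_integral => t _ /=; first by rewrite lee_fin.
  rewrite ger0_norm ?psi0// /psi /patch.
  case: ifPn => [/set_mem Dt|_]; last first.
    by case: ifPn => // /set_mem/=; rewrite in_itv/= andbT => /f0.
  rewrite ifT; last by rewrite inE/= in_itv/= andbT ltW// D0.
  by rewrite EFin_max ge_max f0 ?(ltW (D0 t Dt))//; exact: (Dder t Dt).2.
exists N; split => // t; apply: contra_notP => nNt t0.
have Dt : D t by split => //=; rewrite in_itv/= andbT.
split; first exact: (Dder t Dt).1.
by rewrite /psi /patch ifT ?inE// le_max lexx orbT.
Unshelve. all: by end_near. Qed.

(** [h] is the difference of the bounded nondecreasing primitive of [psi] and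
    of a function that is nondecreasing and bounded above. *)
Lemma cvgy_of_bounded_increments (h psi : R -> R) :
  (forall t, 0 <= t -> 0 <= h t) ->
  (forall t, 0 <= psi t) -> mu.-integrable setT (EFin \o psi) ->
  (forall s t, 0 <= s -> s <= t ->
    h t - h s <=
      \int[mu]_(r in `]-oo, t]) psi r - \int[mu]_(r in `]-oo, s]) psi r) ->
  cvg (h t @[t --> +oo]).
Proof.
move=> h0 psi0 ipsi hpsi.
pose Phi r := \int[mu]_(w in `]-oo, r]) psi w.
have PhiK r : Phi r <= \int[mu]_w psi w by exact: primitive_le_total.
have cvPhi : cvg (Phi t @[t --> +oo]).
  apply/cvg_ex; eexists; apply: nondecreasing_cvgr; first exact: le_primitive.
  by exists (\int[mu]_w psi w) => _ [r _ <-].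
pose k t := Phi (Num.max 0 t) - h (Num.max 0 t).
have cvk : cvg (k t @[t --> +oo]).
  apply/cvg_ex; eexists; apply: nondecreasing_cvgr.
    move=> a b ab; rewrite /k.
    have m0 : 0 <= Num.max 0 a by rewrite le_max lexx.
    have mab : Num.max 0 a <= Num.max 0 b.
      by rewrite ge_max !le_max lexx ab orbT.
    by have := hpsi _ _ m0 mab; rewrite -/(Phi _) -/(Phi _); lra.
  exists (\int[mu]_w psi w) => _ [r _ <-]; rewrite /k.
  have m0 : 0 <= Num.max 0 r by rewrite le_max lexx.
  by have := h0 _ m0; have := PhiK (Num.max 0 r); lra.
move: cvPhi cvk => /cvg_ex[p pE] /cvg_ex[q qE].
have lE : (fun t => Phi t - k t) @ +oo_R --> p - q by apply: cvgB.
apply/cvg_ex; exists (p - q).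
suff e : {near +oo_R, (fun t => Phi t - k t) =1 h}.
  by apply: (cvg_trans _ lE); exact: near_eq_cvg.
near=> t; rewrite /= /k max_r; first by ring.
by near: t; apply: nbhs_pinfty_ge; rewrite num_real.
Unshelve. all: by end_near. Qed.

End AbsContinuity.

(** * Testing Bochner integrals against vectors *)

Section BochnerWeak.
Context {d : measure_display} {T : measurableType d} {R : realType}
  {H : completeNormedModType R} {dot : {dot H for idfun}}.
Context (hdot : inner_norm dot).
Context {mu : {measure set T -> \bar R}} {D : set T}.
Context (mD : measurable D).
Implicit Types (s : step_function (H := H) mu D) (f : T -> H) (h : H).

Lemma integrable_step_indic s (i : 'I_(step_size s)) :
  mu.-integrable D (fun t => (\1_(step_set i) t)%:E).
Proof.
apply/integrableP; split.
  exact/measurable_EFinP/measurable_indic/step_measurable.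
under eq_integral do rewrite gee0_abs ?lee_fin//.
rewrite integral_indic//; last exact: step_measurable.
apply: le_lt_trans (step_finite i); apply: le_measure; rewrite ?inE//.
- by apply: measurableI => //; exact: step_measurable.
- exact: step_measurable.
Qed.

Lemma dot_step_eval s h t :
  dot (step_eval s t) h =
  \sum_(i < step_size s) \1_(step_set i) t * dot (step_val i) h.
Proof.
rewrite /step_eval.
rewrite (big_morph (fun u => dot u h) (fun u v => dotDl u v h) (dot0l h)).
by apply: eq_bigr => i _; rewrite dotZl.
Qed.

Lemma integrable_dot_step s h :
  mu.-integrable D (EFin \o (fun t => dot (step_eval s t) h)).
Proof.
have -> : EFin \o (fun t => dot (step_eval s t) h) =
    fun t => (\sum_(i < step_size s)
      ((dot (step_val i) h)%:E * (\1_(step_set i) t)%:E))%E.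
  apply/funext => t /=; rewrite dot_step_eval -sumEFin.
  by apply: eq_bigr => i _; rewrite -EFinM mulrC.
apply: integrable_sum => // i _; apply: integrableZl => //.
exact: integrable_step_indic.
Qed.

Lemma dot_step_integral s h :
  dot (step_integral s) h = \int[mu]_(t in D) dot (step_eval s t) h.
Proof.
have iA := @integrable_step_indic s.
rewrite /step_integral.
rewrite (big_morph (fun u => dot u h) (fun u v => dotDl u v h) (dot0l h)).
rewrite /Rintegral.
have -> : (\int[mu]_(t in D) (dot (step_eval s t) h)%:E =
    \int[mu]_(t in D) \sum_(i < step_size s)
      ((dot (step_val i) h)%:E * (\1_(step_set i) t)%:E))%E.
  apply: eq_integral => t _; rewrite dot_step_eval -sumEFin.
  by apply: eq_bigr => i _; rewrite -EFinM mulrC.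
rewrite integral_sum//; last by move=> i; exact: integrableZl.
rewrite -sum_fine; last first.
  by move=> i _; apply: integrable_fin_num => //; exact: integrableZl.
apply: eq_bigr => i _.
rewrite integralZl// fineM//; last exact: integrable_fin_num.
rewrite integral_indic//; last exact: step_measurable.
by rewrite (setIidl (@step_sub _ _ _ _ _ _ s i)) dotZl mulrC.
Qed.

(** The comparison behind both characterization and existence of Bochner
    integrals: tested against [h], a step integral misses the integral of [f] by
    at most the integral of the tested error. *)
Lemma dot_step_integral_dist s f h :
  mu.-integrable D (EFin \o (fun t => dot (f t) h)) ->
  (`|dot (step_integral s) h - \int[mu]_(t in D) dot (f t) h|%:E <=
   \int[mu]_(t in D) `|dot (f t - step_eval s t) h|%:E)%E.
Proof.
move=> fh; have sh := integrable_dot_step s h.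
rewrite distrC dot_step_integral -RintegralB//.
have -> : \int[mu]_(t in D) (dot (f t) h - dot (step_eval s t) h) =
    \int[mu]_(t in D) (dot (f t - step_eval s t) h).
  by apply: eq_Rintegral => t _; rewrite dotBl.
have fsh : mu.-integrable D (EFin \o (fun t => dot (f t - step_eval s t) h)).
  rewrite (_ : _ \o _ = (EFin \o (fun t => dot (f t) h)) \-
    (EFin \o (fun t => dot (step_eval s t) h)))%E; first exact: integrableB.
  by apply/funext => t /=; rewrite dotBl.
rewrite EFin_normr_Rintegral//; apply: le_abse_integral => //.
by case/integrableP: fsh.
Qed.

(** Testing against a vector commutes with the Bochner integral.  It is enough
    to test against a multiple [k] of [h] of norm at most 1: the tested error is
    then bounded by the error itself, whose integral may be that of a
    nonmeasurable function and so cannot be scaled. *)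
Lemma dot_bochner_integral f I h :
  (forall k, mu.-integrable D (EFin \o (fun t => dot (f t) k))) ->
  is_bochner_integral mu D f I ->
  dot I h = \int[mu]_(t in D) dot (f t) h.
Proof.
move=> fh [s [_ sf sI]].
pose a := (`|h| + 1)^-1; pose k := a *: h.
have a0 : 0 < a by rewrite invr_gt0 ltr_wpDl.
have k1 : `|k| <= 1.
  by rewrite normrZ gtr0_norm// ler_pdivrMl ?ltr_wpDl// mulr1 lerDl.
have skI : (fun n => dot (step_integral (s n)) k) @ \oo --> dot I k.
  by apply: cvg_dot => //; exact: cvg_cst.
have skf : (fun n => dot (step_integral (s n)) k) @ \oo -->
    \int[mu]_(t in D) dot (f t) k.
  apply: cvg_zero; apply/norm_cvg0P.
  apply: (@fine_cvg _ _ _ _ (fun n => `|dot (step_integral (s n)) k -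
    \int[mu]_(t in D) dot (f t) k|%:E)).
  apply: (@squeeze_cvge _ _ _ _ (cst 0%E) _ _ _ _ _ sf); last exact: cvg_cst.
  apply: nearW => n; rewrite lee_fin normr_ge0/=.
  apply: le_trans (dot_step_integral_dist (s n) f k (fh k)) _.
  apply: ge0_le_lower_integral => t Dt; rewrite lee_fin//.
  apply: le_trans (norm_dot_le hdot _ _) _.
  by rewrite -[leRHS]mulr1 ler_wpM2l.
have : dot I k = \int[mu]_(t in D) dot (f t) k.
  exact: (cvg_unique _ skI skf).
rewrite dotZr; under eq_Rintegral do rewrite dotZr.
by rewrite RintegralZl// => /mulfI; apply; rewrite gt_eqF.
Qed.

(** The weak integral [I] comes from Riesz's theorem; testing
    [step_integral (s n) - I] against itself upgrades the weak estimate to norm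
    convergence. *)
Lemma exists_bochner_integral f (s : nat -> step_function (H := H) mu D) :
  (mu D < +oo)%E ->
  (forall k, mu.-integrable D (EFin \o (fun t => dot (f t) k))) ->
  (forall e, 0 < e -> \forall n \near \oo,
     forall t, D t -> `|f t - step_eval (s n) t| <= e) ->
  exists I, is_bochner_integral mu D f I.
Proof.
move=> muD fh fs.
have bound n e : 0 <= e -> (forall t, D t -> `|f t - step_eval (s n) t| <= e) ->
    (\int[mu]_(t in D) `|f t - step_eval (s n) t|%:E <= (e * fine (mu D))%:E)%E.
  move=> e0 fse; rewrite EFinM fineK ?ge0_fin_numE//.
  rewrite -integral_cst//.
  apply: ge0_le_lower_integral => t Dt; rewrite lee_fin//.
  exact: fse.
have D0 : 0 <= fine (mu D) by exact: fine_ge0.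
have [N fsN] := filter_ex (fs 1 ltr01).
pose K := 1 + \sum_(i < step_size (s N)) `|step_val (s := s N) i|.
have fK t : D t -> `|f t| <= K.
  move=> Dt; rewrite -[f t](subrK (step_eval (s N) t)).
  apply: le_trans (ler_normD _ _) _; apply: lerD; first exact: fsN.
  apply: le_trans (ler_norm_sum _ _ _) _; apply: ler_sum => i _.
  rewrite normrZ indicE.
  by case: (_ \in _); rewrite ?normr1 ?normr0 ?mul1r ?mul0r.
have [||I LI] := riesz hdot (fun h => \int[mu]_(t in D) dot (f t) h)
  (K * fine (mu D)).
- move=> a u v.
  under eq_Rintegral do rewrite dotDr dotZr.
  rewrite RintegralD//; last first.
    rewrite (_ : _ \o _ = fun t => (a%:E * (dot (f t) u)%:E)%E)//.
    exact: (integrableZl mD _ (fh u)).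
  by rewrite RintegralZl.
- move=> h; rewrite mulrAC -lee_fin EFin_normr_Rintegral//.
  apply: le_trans (le_abse_integral _ mD _) _.
    by case/integrableP: (fh h).
  rewrite EFinM fineK ?ge0_fin_numE// -integral_cst//.
  apply: ge0_le_lower_integral => t Dt; rewrite lee_fin//.
  by apply: le_trans (norm_dot_le hdot _ _) _; rewrite ler_wpM2r// fK.
exists I, s; split.
- apply/aeW => t Dt; apply/cvgrPdist_le => e e0.
  by apply: filterS (fs e e0) => n; exact.
- have D1 : 0 < fine (mu D) + 1 by rewrite ltr_wpDl.
  have small e : 0 < e -> \forall n \near \oo,
      (\int[mu]_(t in D) `|f t - step_eval (s n) t|%:E <= e%:E)%E.
    move=> e0; have e'0 : 0 < e / (fine (mu D) + 1) by rewrite divr_gt0.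
    apply: filterS (fs _ e'0) => n fsn.
    apply: le_trans (bound n _ (ltW e'0) fsn) _; rewrite lee_fin.
    by rewrite mulrAC ler_pdivrMr// ler_wpM2l ?(ltW e0)// lerDl.
  have ge0 n : (0 <= \int[mu]_(t in D) `|f t - step_eval (s n) t|%:E)%E.
    by apply: integral_ge0 => t _; rewrite lee_fin.
  apply: cvg_EFin.
    apply: filterS (small 1 ltr01) => n n1.
    by rewrite ge0_fin_numE// (le_lt_trans n1)// ltry.
  apply/cvgrPdist_le => e e0; apply: filterS (small e e0) => n ne.
  rewrite /= sub0r normrN ger0_norm ?fine_ge0//.
  by rewrite -lee_fin fineK// ge0_fin_numE// (le_lt_trans ne)// ltry.
- apply/cvgrPdist_le => e e0.
  have D1 : 0 < fine (mu D) + 1 by rewrite ltr_wpDl.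
  have e'0 : 0 < e / (fine (mu D) + 1) by rewrite divr_gt0.
  apply: filterS (fs _ e'0) => n fsn.
  rewrite distrC; set k := step_integral (s n) - I.
  have [->|k0] := eqVneq k 0; first by rewrite normr0 ltW.
  have kn : 0 < `|k| by rewrite normr_gt0.
  rewrite -(ler_pM2r kn) -expr2 -hdot {1}/k dotBl.
  have -> : dot I k = \int[mu]_(t in D) dot (f t) k by rewrite -LI.
  apply: le_trans (ler_norm _) _; rewrite -lee_fin.
  apply: le_trans (dot_step_integral_dist (s n) f k (fh k)) _.
  apply: (@le_trans _ _
    (\int[mu]_(t in D) (cst (e / (fine (mu D) + 1) * `|k|)%:E t))%E).
    apply: ge0_le_lower_integral => t Dt; rewrite lee_fin//.
    by apply: le_trans (norm_dot_le hdot _ _) _; rewrite ler_wpM2r// fsn.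
  rewrite integral_cst// -[mu D]fineK ?ge0_fin_numE// -EFinM lee_fin.
  rewrite mulrAC ler_wpM2r// mulrAC ler_pdivrMr//.
  by rewrite ler_wpM2l ?(ltW e0)// lerDl.
Qed.

End BochnerWeak.

(** * Integrals of continuous functions over growing segments *)

Section ContinuousIntegrals.
Context {R : realType}.
Notation mu := (@lebesgue_measure R).

Lemma continuous_integrable_itv (f : R -> R) (a b : R) :
  continuous f -> mu.-integrable `[a, b] (EFin \o f).
Proof.
move=> cf; apply: continuous_compact_integrable; first exact: segment_compact.
exact: continuous_subspaceT.
Qed.

Lemma Rintegral_increment (f : R -> R) (u v : R) :
  continuous f -> 0 <= u -> u <= v ->
  \int[mu]_(t in `[0, v]) f t - \int[mu]_(t in `[0, u]) f t =
  \int[mu]_(t in `]u, v]) f t.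
Proof.
move=> cf u0 uv; apply: Rintegral_itvB; rewrite ?bnd_simp//.
exact: continuous_integrable_itv.
Qed.

Lemma norm_Rintegral_increment_le (f : R -> R) (u v M : R) :
  continuous f -> 0 <= u -> u <= v ->
  (forall t, u < t -> t <= v -> `|f t| <= M) ->
  `|\int[mu]_(t in `[0, v]) f t - \int[mu]_(t in `[0, u]) f t| <= M * (v - u).
Proof.
move=> cf u0 uv fM; rewrite Rintegral_increment//.
have iuv (g : R -> R) : continuous g -> mu.-integrable `]u, v] (EFin \o g).
  move=> cg; apply: integrableS (continuous_integrable_itv g u v cg) => //.
  by apply: subset_itvr; rewrite bnd_simp.
apply: le_trans (le_normr_Rintegral _ _) _ => //; first exact: iuv.
have -> : M * (v - u) = \int[mu]_(t in `]u, v]) (cst M t).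
  rewrite Rintegral_cst//= lebesgue_measure_itv/= lte_fin; case: ltP => //= vu.
  by rewrite (@le_anti _ _ u v) ?uv// subrr.
apply: le_Rintegral => //.
- by apply: (iuv (fun t => `|f t|)) => t; apply: cvg_norm; exact: cf.
- by apply: iuv => t; exact: cvg_cst.
- by move=> t /=; rewrite in_itv/= => /andP[]; exact: fM.
Qed.

Lemma continuous_bounded_itv (f : R -> R) (T : R) : 0 <= T -> continuous f ->
  exists M, forall t, 0 <= t -> t <= T -> `|f t| <= M.
Proof.
move=> T0 cf.
have [|c _ cmax] := @EVT_max R (fun t => `|f t|) 0 T T0.
  by apply: continuous_subspaceT => t; apply: cvg_norm; exact: cf.
by exists `|f c| => t t0 tT; apply: cmax; rewrite in_itv/= t0.
Qed.

Lemma abs_continuous_Rintegral (f : R -> R) (T : R) : 0 <= T -> continuous f ->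
  abs_continuous 0 T (fun t => \int[mu]_(r in `[0, t]) f r : R^o).
Proof.
move=> T0 cf; have [M fM] := continuous_bounded_itv f T T0 cf.
apply: (abs_continuous_dominated 0 T M _ _ _ (abs_continuous_id 0 T)).
move=> u v u0 uv vT; rewrite [X in _ * X]ger0_norm ?subr_ge0//.
apply: norm_Rintegral_increment_le => // t ut tv.
by apply: fM; [exact: le_trans u0 (ltW ut)|exact: le_trans tv vT].
Qed.

(** The part of the integral before a large time [T'] is a constant, killed by
    the division by [t]; after [T'] the integrand is within [e / 2] of [l]. *)
Lemma cesaro_cvgy (f : R -> R) (l : R) :
  continuous f -> f t @[t --> +oo] --> l ->
  t^-1 * \int[mu]_(r in `[0, t]) f r @[t --> +oo] --> l.
Proof.
move=> cf fl; apply/cvgrPdist_le => e e0.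
have e2 : 0 < e / 2 by rewrite divr_gt0.
move/cvgrPdist_le : fl => /(_ _ e2) [T [_ fT]].
pose T' := Num.max 0 T.
have T'0 : 0 <= T' by rewrite le_max lexx.
pose g r := f r - l.
have cg : continuous g by move=> r; apply: cvgB; [exact: cf|exact: cvg_cst].
pose C := `|\int[mu]_(r in `[0, T']) g r|.
near=> t.
have t0 : 0 < t by near: t; apply: nbhs_pinfty_gt; rewrite num_real.
have tT' : T' <= t by near: t; apply: nbhs_pinfty_ge; rewrite num_real.
have tC : C / (e / 2) <= t by near: t; apply: nbhs_pinfty_ge; rewrite num_real.
have -> : l - t^-1 * \int[mu]_(r in `[0, t]) f r =
    - (t^-1 * \int[mu]_(r in `[0, t]) g r).
  rewrite /g RintegralB//; [|exact: continuous_integrable_itv|].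
    rewrite Rintegral_cst//= lebesgue_measure_itv/= lte_fin t0/= subr0.
    by field; rewrite gt_eqF.
  by apply: continuous_integrable_itv => r; exact: cvg_cst.
rewrite normrN normrM gtr0_norm ?invr_gt0// ler_pdivrMl//.
have : `|\int[mu]_(r in `[0, t]) g r - \int[mu]_(r in `[0, T']) g r| <=
    e / 2 * (t - T').
  apply: norm_Rintegral_increment_le => // r T'r rt.
  rewrite /g distrC; apply: fT.
  by apply: le_lt_trans T'r; rewrite le_max lexx orbT.
rewrite ler_pdivrMr// in tC.
have := ler_normD
  (\int[mu]_(r in `[0, t]) g r - \int[mu]_(r in `[0, T']) g r)
  (\int[mu]_(r in `[0, T']) g r).
rewrite subrK -/C => h1 h2.
apply: le_trans h1 _; apply: le_trans (lerD h2 tC) _.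
have -> : e / 2 * (t - T') + t * (e / 2) = t * e - e / 2 * T' by field.
by rewrite gerBl mulr_ge0// ltW.
Unshelve. all: by end_near. Qed.

End ContinuousIntegrals.

(** * Time averages *)

Section TimeAverage.
Context {R : realType} {H : completeNormedModType R} {dot : {dot H for idfun}}.
Context (hdot : inner_norm dot).
Notation mu := (@lebesgue_measure R).

(** The [i]-th piece of the subdivision of [`[0, t]] with mesh [t / n.+1].  The
    last index [n.+1] is there for the single point [t]. *)
Definition cell (t : R) (n : nat) (i : 'I_n.+2) : set R :=
  [set r | 0 <= r <= t /\ Num.truncn (r / (t / n.+1%:R)) = i].

Lemma measurable_cell t n i : 0 < t -> measurable (cell t n i).
Proof.
move=> t0; have dl0 : 0 < t / n.+1%:R by rewrite divr_gt0.
rewrite /cell; set dl := t / n.+1%:R in dl0 *.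
have -> : [set r | 0 <= r <= t /\ Num.truncn (r / dl) = i] =
    `[0, t]%classic `&` `[i%:R * dl, i.+1%:R * dl[%classic.
  apply/seteqP; split => r /=; rewrite !in_itv/=.
    move=> [/andP[r0 rt] /eqP].
    rewrite truncn_eq; last exact: divr_ge0 (ltW dl0).
    by rewrite ler_pdivlMr// ltr_pdivrMr// => ?; split => //; rewrite r0.
  move=> [/andP[r0 rt] ri]; split; first by rewrite r0.
  apply/eqP; rewrite truncn_eq; last exact: divr_ge0 (ltW dl0).
  by rewrite ler_pdivlMr// ltr_pdivrMr.
by apply: measurableI; exact: measurable_itv.
Qed.

Lemma cell_sub t n i : cell t n i `<=` `[0, t]%classic.
Proof. by move=> r []; rewrite /= in_itv. Qed.

Lemma mu_segment (t : R) : 0 <= t -> mu `[0, t]%classic = t%:E.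
Proof.
move=> t0; rewrite lebesgue_measure_itv/= lte_fin; case: ltP => h.
  by rewrite -EFinB subr0.
by have -> : t = 0 by apply/le_anti; rewrite t0 h.
Qed.

Lemma cell_finite t n i : 0 < t -> (mu (cell t n i) < +oo)%E.
Proof.
move=> t0; apply: (@le_lt_trans _ _ (mu `[0, t]%classic)).
  apply: le_measure; rewrite ?inE//; [exact: measurable_cell|exact: cell_sub].
by rewrite mu_segment ?ltry// ltW.
Qed.

(** Constant on each cell, with the value of [x] at its left end. *)
Definition uniform_step (x : R -> H) (t : R) (t0 : 0 < t) (n : nat) :
    step_function (H := H) mu `[0, t]%classic :=
  @StepFunction _ _ R H mu `[0, t]%classic n.+2 (cell t n)
    (fun i => x (i%:R * (t / n.+1%:R)))
    (fun i => measurable_cell t n i t0) (cell_sub t n)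
    (fun i => cell_finite t n i t0).

Lemma uniform_stepE x t (t0 : 0 < t) n r : 0 <= r -> r <= t ->
  step_eval (uniform_step x t t0 n) r =
  x ((Num.truncn (r / (t / n.+1%:R)))%:R * (t / n.+1%:R)).
Proof.
move=> r0 rt; have dl0 : 0 < t / n.+1%:R by rewrite divr_gt0.
have kn : (Num.truncn (r / (t / n.+1%:R)) < n.+2)%N.
  rewrite truncn_lt_nat; last exact: divr_ge0 (ltW dl0).
  rewrite ltr_pdivrMr// mulrCA.
  apply: (le_lt_trans rt); rewrite ltr_pMr// ltr_pdivlMr// mul1r.
  by rewrite ltr_nat.
rewrite /step_eval (bigD1 (Ordinal kn))//= indicE mem_set ?scale1r; last first.
  by split => //; rewrite r0.
rewrite big1 ?addr0// => i ik; rewrite indicE memNset ?scale0r// => -[_ ki].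
by move: ik => /eqP; apply; apply: val_inj.
Qed.

Lemma uniform_step_cvg x t (t0 : 0 < t) : abs_continuous 0 t x ->
  forall e, 0 < e -> \forall n \near \oo, forall r, `[0, t]%classic r ->
    `|x r - step_eval (uniform_step x t t0 n) r| <= e.
Proof.
move=> acx e e0; have [d d0 xd] := abs_continuous_unif acx e e0.
have dt0 : 0 < d / t by rewrite divr_gt0.
near=> n => r /=; rewrite in_itv/= => /andP[r0 rt].
have dl0 : 0 < t / n.+1%:R by rewrite divr_gt0.
have dld : t / n.+1%:R < d.
  rewrite mulrC -ltr_pdivlMr//; near: n.
  exact: (near_infty_natSinv_lt (PosNum dt0)).
have /truncn_itv/andP[] : 0 <= r / (t / n.+1%:R) by exact: divr_ge0 (ltW dl0).
rewrite ler_pdivlMr// ltr_pdivrMr//.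
rewrite -[(Num.truncn _).+1%:R]natr1 mulrDl mul1r => kr rk.
rewrite uniform_stepE//; apply/ltW/xd => //.
- by rewrite mulr_ge0// ltW.
- exact: le_trans kr rt.
- by rewrite ger0_norm ?subr_ge0// ltrBlDl (lt_trans rk)// ltrD2l.
Unshelve. all: by end_near. Qed.

Lemma dot_continuous_max0 (x : R -> H) (h : H) :
  (forall T, 0 <= T -> abs_continuous 0 T x) ->
  continuous (fun t : R => dot (x (Num.max 0 t)) h).
Proof.
move=> acx t; apply: cvg_dot => //; last exact: cvg_cst.
exact: (max0_continuous x acx).
Qed.

(** On the right the integrand is written as a function continuous on the whole
    line, the form in which the other results on integrals apply. *)
Lemma dot_time_average (x : R -> H) (t : R) (h : H) :
  (forall T, 0 <= T -> abs_continuous 0 T x) -> 0 < t ->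
  dot (time_average x t) h =
  t^-1 * \int[mu]_(r in `[0, t]) dot (x (Num.max 0 r)) h.
Proof.
move=> acx t0.
have ix k : mu.-integrable `[0, t] (EFin \o (fun r => dot (x r) k)).
  apply: (@eq_integrable _ _ _ mu `[0, t]%classic _
    (EFin \o (fun r => dot (x (Num.max 0 r)) k))) => //.
    by move=> r; rewrite inE/= in_itv/= => /andP[r0 _]; rewrite max_r.
  exact: continuous_integrable_itv (dot_continuous_max0 x k acx).
rewrite /time_average dotZl; congr (_ * _).
rewrite (@dot_bochner_integral _ _ R H dot hdot mu `[0, t]%classic _ x)//;
  last first.
  apply: xgetPex.
  apply: (@exists_bochner_integral _ _ R H dot hdot mu `[0, t]%classic _ x
    (uniform_step x t t0)) => //.
    rewrite [X in (X < _)%E](_ : _ = t%:E) ?ltry//.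
    exact: mu_segment (ltW t0).
  exact: uniform_step_cvg (acx t (ltW t0)).
apply: eq_Rintegral => r; rewrite inE/= in_itv/= => /andP[r0 _].
by rewrite max_r.
Qed.

Lemma dot_time_average_sub (x : R -> H) (u w : H) (t : R) :
  (forall T, 0 <= T -> abs_continuous 0 T x) -> 0 < t ->
  dot (time_average x t - u) w =
  t^-1 * \int[mu]_(r in `[0, t]) dot (x (Num.max 0 r) - u) w.
Proof.
move=> acx t0; rewrite dotBl dot_time_average//.
under [in RHS]eq_Rintegral do rewrite dotBl.
rewrite RintegralB//; last 2 first.
- exact: continuous_integrable_itv (dot_continuous_max0 x w acx).
- by apply: continuous_integrable_itv => r; exact: cvg_cst.
rewrite Rintegral_cst//= [X in fine X](_ : _ = t%:E); last first.
  exact: mu_segment (ltW t0).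
by rewrite /= mulrBr mulrCA mulVf ?mulr1// gt_eqF.
Qed.

Lemma norm_time_average_le (x : R -> H) (M t : R) :
  (forall T, 0 <= T -> abs_continuous 0 T x) -> 0 < t ->
  (forall r, 0 <= r -> `|x r| <= M) -> `|time_average x t| <= M.
Proof.
move=> acx t0 xM; set X := time_average x t.
have M0 : 0 <= M by exact: le_trans (normr_ge0 _) (xM 0 (lexx 0)).
have [->|X0] := eqVneq X 0; first by rewrite normr0.
have Xn : 0 < `|X| by rewrite normr_gt0.
rewrite -(ler_pM2r Xn) -expr2 -hdot {1}/X dot_time_average//.
rewrite ler_pdivrMl//; apply: le_trans (ler_norm _) _.
have cX := dot_continuous_max0 x X acx.
have := norm_Rintegral_increment_le _ 0 t (M * `|X|) cX (lexx 0) (ltW t0).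
rewrite set_itv1 Rintegral_set1 !subr0 [t * _]mulrC; apply => r r0 rt.
apply: le_trans (norm_dot_le hdot _ _) _; rewrite ler_wpM2r//.
by rewrite max_r ?(ltW r0)// xM// ltW.
Qed.

Lemma time_average_cvg_dot (x : R -> H) (h : H) (c : R) :
  (forall T, 0 <= T -> abs_continuous 0 T x) ->
  dot (x t) h @[t --> +oo] --> c ->
  dot (time_average x t) h @[t --> +oo] --> c.
Proof.
move=> acx xc.
have xc' : dot (x (Num.max 0 t)) h @[t --> +oo] --> c.
  apply: cvg_trans xc; apply: near_eq_cvg; near=> t.
  have t0 : 0 <= t by near: t; apply: nbhs_pinfty_ge; rewrite num_real.
  by rewrite max_r.
apply: cvg_trans (cesaro_cvgy _ c (dot_continuous_max0 x h acx) xc').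
apply: near_eq_cvg; near=> t.
have t0 : 0 < t by near: t; apply: nbhs_pinfty_gt; rewrite num_real.
by rewrite dot_time_average.
Unshelve. all: by end_near. Qed.

End TimeAverage.

(** * Squared distance to a point along a curve *)

Definition half_sqdist {R : realType} {H : normedModType R} (dot : H -> H -> R)
    (x : R -> H) (u : H) (t : R) : R :=
  2^-1 * dot (x t - u) (x t - u).

Section HalfSqdist.
Context {R : realType} {H : completeNormedModType R} {dot : {dot H for idfun}}.
Context (hdot : inner_norm dot).

Lemma half_sqdist_ge0 x u t : 0 <= half_sqdist dot x u t.
Proof. by rewrite /half_sqdist mulr_ge0// (dot_ge0 hdot). Qed.

Lemma half_sqdist_increment x u s t :
  half_sqdist dot x u t - half_sqdist dot x u s =
  2^-1 * dot (x t - x s) (x t + x s - 2 *: u).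
Proof.
rewrite /half_sqdist !(dotBl, dotBr, dotDl, dotDr, dotZr) (dotC (x s) (x t)).
rewrite (dotC (x t) u) (dotC (x s) u); lra.
Qed.

Lemma norm_bounded_itv (x : R -> H) (T : R) :
  (forall T, 0 <= T -> abs_continuous 0 T x) -> 0 <= T ->
  exists M, forall t, 0 <= t -> t <= T -> `|x t| <= M.
Proof.
move=> acx T0.
have [|M xM] := continuous_bounded_itv (fun t : R => `|x (Num.max 0 t)|) T T0.
  by move=> t; apply: cvg_norm; exact: (max0_continuous x acx).
by exists M => t t0 tT; have := xM t t0 tT; rewrite normr_id max_r.
Qed.

Lemma abs_continuous_half_sqdist (x : R -> H) (u : H) (T : R) :
  (forall T, 0 <= T -> abs_continuous 0 T x) -> 0 <= T ->
  abs_continuous 0 T (half_sqdist dot x u : R -> R^o).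
Proof.
move=> acx T0; have [M xM] := norm_bounded_itv x T acx T0.
apply: (abs_continuous_dominated 0 T (M + `|u|) x _ _ (acx T T0)).
move=> s t s0 st tT.
have sM := xM s s0 (le_trans st tT); have tM := xM t (le_trans s0 st) tT.
rewrite half_sqdist_increment normrM gtr0_norm ?invr_gt0//.
have := norm_dot_le hdot (x t - x s) (x t + x s - 2 *: u).
have : `|x t + x s - 2 *: u| <= 2 * (M + `|u|).
  apply: le_trans (ler_normB _ _) _; rewrite normrZ gtr0_norm//.
  by have := ler_normD (x t) (x s); lra.
move=> /(ler_wpM2l (normr_ge0 (x t - x s))).
set a := `|x t - x s|; set b := `|dot _ _|.
by rewrite !(mulrC _ a); lra.
Qed.

(** [half_sqdist_increment] factors the difference quotient as a product of a
    difference quotient of [x] and of a continuous factor. *)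
Lemma is_derive_half_sqdist (x : R -> H) (u : H) (t : R) :
  derivable x t 1 ->
  is_derive t (1 : R) (half_sqdist dot x u : R -> R^o)
    (dot (derive1 x t) (x t - u)).
Proof.
move=> dx.
have qx : k^-1 *: (x (k *: 1 + t) - x t) @[k --> (0:R)^'] --> derive1 x t.
  by rewrite derive1E; exact: dx.
have cx : x (k *: 1 + t) @[k --> (0:R)^'] --> x t.
  have : k *: (k^-1 *: (x (k *: 1 + t) - x t)) + x t @[k --> (0:R)^'] -->
      0 *: derive1 x t + x t.
    apply: cvgD; last exact: cvg_cst.
    by apply: cvgZ => //; apply: cvg_within; exact: cvg_id.
  rewrite scale0r add0r; apply: cvg_trans; apply: near_eq_cvg.
  near=> k; have k0 : k != 0 by near: k; exact: nbhs_dnbhs_neq.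
  by rewrite scalerA mulfV// scale1r subrK.
have cvgq : k^-1 *: (half_sqdist dot x u (k *: 1 + t) -
                     half_sqdist dot x u t : R^o)
    @[k --> (0:R)^'] --> dot (derive1 x t) (x t - u).
  have : 2^-1 * dot (k^-1 *: (x (k *: 1 + t) - x t))
                    (x (k *: 1 + t) + x t - 2 *: u)
      @[k --> (0:R)^'] --> 2^-1 * dot (derive1 x t) (x t + x t - 2 *: u).
    apply: cvgM; first exact: cvg_cst.
    apply: (cvg_dot hdot) => //; apply: cvgB; last exact: cvg_cst.
    by apply: cvgD => //; exact: cvg_cst.
  have -> : 2^-1 * dot (derive1 x t) (x t + x t - 2 *: u) =
      dot (derive1 x t) (x t - u).
    by rewrite !(dotBr, dotDr, dotZr); lra.
  apply: cvg_trans; apply: near_eq_cvg; apply: nearW => k.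
  by rewrite half_sqdist_increment dotZl; exact: mulrCA.
split; first by apply/cvg_ex; eexists; exact: cvgq.
exact: (cvg_lim _ cvgq).
Unshelve. all: by end_near. Qed.

(** By polarization, [half_sqdist dot x v t - half_sqdist dot x u t] is
    [<x t, u - v>] up to a constant. *)
Lemma half_sqdist_cvg_dot (x : R -> H) (u v : H) :
  cvg (half_sqdist dot x u t @[t --> +oo]) ->
  cvg (half_sqdist dot x v t @[t --> +oo]) ->
  cvg (dot (x t) (u - v) @[t --> +oo]).
Proof.
move=> /cvg_ex[a ua] /cvg_ex[b vb].
apply/cvg_ex; exists (b - a + 2^-1 * (dot u u - dot v v)).
have -> : (fun t => dot (x t) (u - v)) = (fun t => half_sqdist dot x v t -
    half_sqdist dot x u t + 2^-1 * (dot u u - dot v v)).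
  apply/funext => t; rewrite /half_sqdist !(dotBl, dotBr).
  by rewrite (dotC u (x t)) (dotC v (x t)); lra.
by apply: cvgD; [exact: cvgB|exact: cvg_cst].
Qed.

End HalfSqdist.

(** * Maximal monotone operators *)

Section MaximalMonotone.
Context {R : realType} {H : completeNormedModType R} {dot : {dot H for idfun}}.

(** Adding [(l, v)] to the graph of [M] would keep it monotone. *)
Lemma maximal_monotone_mem (M : operator H) (l v : H) :
  maximal_monotone dot M ->
  (forall u w, M u w -> 0 <= dot (u - l) (w - v)) -> M l v.
Proof.
move=> [monoM maxM] lM; apply: contrapT => nMl; apply: maxM.
exists (fun z => [set w | M z w \/ z = l /\ w = v]); split; last first.
  split; first by move=> [z w] /= ?; left.
  move=> /(_ (l, v))/= h; apply: nMl; apply: h; by right.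
move=> [z w] [z' w']; rewrite /gph /= => -[Mz|[-> ->]] [Mz'|[-> ->]].
- exact: (monoM (z, w) (z', w')).
- by have := lM z w Mz; rewrite !(dotBl, dotBr); lra.
- exact: lM.
- by rewrite !subrr dot0l.
Qed.

Lemma brezis_haraux_ge0 (M : operator H) (z u : H) :
  zeros M z -> (0 <= brezis_haraux dot M z u)%E.
Proof.
move=> Mz; apply: ereal_sup_ubound; exists (z, 0) => //=.
by rewrite subrr dot0l.
Qed.

End MaximalMonotone.

(** * The energy inequality *)

(** The primitive of [<x - u, w>] is included so that the differential
    inequality for the distance to [u] becomes an upper bound on the derivative
    of a single absolutely continuous function. *)
Definition energy {R : realType} {H : normedModType R} (dot : H -> H -> R)
    (x : R -> H) (u w : H) (t : R) : R :=
  half_sqdist dot x u t +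
  \int[@lebesgue_measure R]_(r in `[0, t]) dot (x (Num.max 0 r) - u) w.

Section Energy.
Context {R : realType} {H : completeNormedModType R} {dot : {dot H for idfun}}.
Context (hdot : inner_norm dot).
Notation mu := (@lebesgue_measure R).

(** Here [v] is the velocity at the point [z].  After the velocity is replaced
    by [- a' - b *: b'], the difference of the two sides is the sum of
    [<z - u, a' - a>], nonnegative by monotonicity of [A], and of [b]
    times the gap between the supremum and its value at [(z, b')]. *)
Lemma energy_rate_le (A B : operator H) (b : R) (u a q z v a' b' : H) :
  monotone_op dot A -> 0 < b -> A u a -> A z a' -> B z b' ->
  v + a' + b *: b' = 0 ->
  ((dot v (z - u) + dot (z - u) (a + q))%:E <=
   b%:E * brezis_haraux dot B u (b^-1 *: q))%E.
Proof.
move=> monoA b0 Aua Aza' Bzb' veq.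
apply: (@le_trans _ _ (b%:E * (dot (u - z) (b' - b^-1 *: q))%:E)%E).
  rewrite -EFinM lee_fin.
  have := monoA (u, a) (z, a') Aua Aza' => /=.
  have -> : v = - a' - b *: b'.
    by apply/eqP; rewrite -subr_eq0 !opprD !opprK addrA veq.
  rewrite (dotC _ (z - u)) !(dotBl, dotBr, dotDr, dotNr, dotZr).
  rewrite !mulrBr !mulrA !mulfV ?gt_eqF// !mul1r; lra.
apply: lee_wpmul2l; first by rewrite lee_fin ltW.
by apply: ereal_sup_ubound; exists (z, b').
Qed.

Lemma energy_increments (A B : operator H) (beta : R -> R) (x : R -> H)
    (u a q : H) :
  monotone_op dot A -> (forall t, 0 <= t -> 0 < beta t) ->
  zeros B u -> A u a ->
  (\int[mu]_(t in `[0%R, +oo[%classic)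
     ((beta t)%:E * brezis_haraux dot B u ((beta t)^-1 *: q)) < +oo)%E ->
  strong_global_solution A B beta x ->
  exists psi : R -> R,
    [/\ forall t, 0 <= psi t, mu.-integrable setT (EFin \o psi) &
        forall s t, 0 <= s -> s <= t ->
        energy dot x u (a + q) t - energy dot x u (a + q) s <=
        \int[mu]_(r in `]-oo, t]) psi r - \int[mu]_(r in `]-oo, s]) psi r].
Proof.
move=> monoA beta0 Bu Aua intG [acx solx].
set w := a + q.
pose p (r : R) := dot (x (Num.max 0 r) - u) w.
have cp : continuous p.
  move=> r; apply: (cvg_dot hdot); last exact: cvg_cst.
  by apply: cvgB; [exact: (max0_continuous x acx)|exact: cvg_cst].
have acE T : 0 <= T -> abs_continuous 0 T (energy dot x u w : R -> R^o).
  move=> T0; apply: abs_continuousD.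
    exact: (abs_continuous_half_sqdist hdot).
  exact: abs_continuous_Rintegral.
have derE : {ae mu, forall t : R, 0 < t ->
    derivable (energy dot x u w : R -> R^o) t 1 /\
    ((derive1 (energy dot x u w : R -> R^o) t)%:E <=
      (beta t)%:E * brezis_haraux dot B u ((beta t)^-1 *: q))%E}.
  apply: filterS solx; first exact: (ae_filter_ringOfSetsType mu).
  move=> t + t0 => /(_ t0)[dx [a' [b' [Aa' Bb' veq]]]].
  have hder := is_derive_half_sqdist hdot x u t dx.
  have t1 : t < t + 1 by rewrite ltrDl.
  have [dP Pt] := @continuous_FTC1_closed R p 0 t (t + 1) t1
    (continuous_integrable_itv p 0 (t + 1) cp) t0 (cp t).
  have dEt : is_derive t (1 : R) (energy dot x u w : R -> R^o)
      (dot (derive1 x t) (x t - u) + p t).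
    apply: is_deriveD; split; first exact: dP.
    by rewrite -derive1E.
  split; first by case: dEt.
  rewrite derive1E (@derive_val _ _ _ _ _ _ _ dEt) /p max_r ?(ltW t0)//.
  exact: (energy_rate_le A B _ u a q _ _ a' b' monoA (beta0 t (ltW t0))).
have G0 t : 0 <= t ->
    (0 <= (beta t)%:E * brezis_haraux dot B u ((beta t)^-1 *: q))%E.
  move=> t0; apply: mule_ge0; first by rewrite lee_fin ltW// beta0.
  exact: brezis_haraux_ge0.
have [psi [psi0 ipsi dpsi]] := exists_integrable_slope _ _ G0 intG acE derE.
by exists psi; split => //; exact: abs_continuous_increment_le.
Qed.

Lemma energy_bounded (x : R -> H) (u w : H) (psi : R -> R) :
  (forall t, 0 <= psi t) -> mu.-integrable setT (EFin \o psi) ->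
  (forall s t, 0 <= s -> s <= t -> energy dot x u w t - energy dot x u w s <=
        \int[mu]_(r in `]-oo, t]) psi r - \int[mu]_(r in `]-oo, s]) psi r) ->
  exists C, forall t, 0 <= t -> energy dot x u w t <= C.
Proof.
move=> psi0 ipsi inc.
exists (energy dot x u w 0 + \int[mu]_r psi r) => t t0.
have := inc 0 t (lexx 0) t0.
have : 0 <= \int[mu]_(r in `]-oo, 0]) psi r by exact: Rintegral_ge0.
by have := primitive_le_total psi t psi0 ipsi; lra.
Qed.

Lemma energy0 (x : R -> H) (u : H) : energy dot x u 0 = half_sqdist dot x u.
Proof.
apply/funext => t; rewrite /energy.
under eq_Rintegral do rewrite dot0r.
by rewrite Rintegral_cst ?mul0r ?addr0.
Qed.

End Energy.

(** * Weak convergence of averages *)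

Section Ergodic.
Context {R : realType} {H : completeNormedModType R} {dot : {dot H for idfun}}.
Context (hdot : inner_norm dot).

(** Passing to the limit in the bound gives [0 <= <u - l, w - 0>] for all
    [(u, w)] in the graph, and maximality concludes. *)
Lemma weak_limit_zero (M : operator H) (X : R -> H) (l : H)
    (F : set_system R) {FF : ProperFilter F} :
  maximal_monotone dot M -> pinfty_nbhs R `<=` F -> weakly_cvg dot F X l ->
  (forall u w, M u w ->
    exists C, forall t, 0 < t -> dot (X t - u) w <= C / t) ->
  zeros M l.
Proof.
move=> maxM infF Xl bound; apply: maximal_monotone_mem maxM _ => // u w Muw.
have [C XC] := bound u w Muw.
rewrite subr0 -oppr_le0 -mulN1r -dotZl scaleN1r opprB.
have lhs : dot (X t - u) w @[t --> F] --> dot (l - u) w.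
  under eq_fun do rewrite dotBl.
  by rewrite dotBl; apply: cvgB; [exact: Xl|exact: cvg_cst].
have rhs : C / t @[t --> F] --> 0.
  rewrite -(mulr0 C); apply: cvgM; first exact: cvg_cst.
  apply: (@cvg_trans _ (t^-1 @[t --> pinfty_nbhs R])).
    by move=> P; exact: infF.
  apply/cvgrPdist_le => e e0; near=> t.
  have t0 : 0 < t by near: t; apply: nbhs_pinfty_gt; rewrite num_real.
  have te : e^-1 <= t by near: t; apply: nbhs_pinfty_ge; rewrite num_real.
  by rewrite sub0r normrN gtr0_norm ?invr_gt0// invf_ple.
apply: (ler_cvg_to lhs rhs); apply: infF; near=> t; apply: XC.
by near: t; apply: nbhs_pinfty_gt; rewrite num_real.
Unshelve. all: by end_near. Qed.

(** Opial's argument for averages: existence of weak cluster points is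
    [weakly_cvg_ultra]; two of them, [l] and [l'], give the same value to
    [<., l - l'>], namely the limit of [<x t, l - l'>]. *)
Lemma opial_time_average (S : set H) (x : R -> H) (M : R) :
  (forall T, 0 <= T -> abs_continuous 0 T x) ->
  (forall t, 0 <= t -> `|x t| <= M) ->
  (forall u, S u -> cvg (half_sqdist dot x u t @[t --> +oo])) ->
  (forall (U : set_system R) l, ProperFilter U -> pinfty_nbhs R `<=` U ->
     weakly_cvg dot U (time_average x) l -> S l) ->
  exists2 l, S l & weakly_cvg dot (pinfty_nbhs R) (time_average x) l.
Proof.
move=> acx xM cvgS clusterS.
have cluster U : UltraFilter U -> pinfty_nbhs R `<=` U ->
    exists2 l, S l & weakly_cvg dot U (time_average x) l.
  move=> UU infU; have UP := @ultra_proper _ _ UU.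
  have [|l Ul] := @weakly_cvg_ultra _ _ _ hdot _ U UU (time_average x) M.
    apply: infU; near=> t.
    have t0 : 0 < t by near: t; apply: nbhs_pinfty_gt; rewrite num_real.
    exact: (norm_time_average_le hdot).
  by exists l => //; exact: clusterS Ul.
have [U0 [UU0 infU0]] := @ultraFilterLemma _ (pinfty_nbhs R) _.
have UP0 := @ultra_proper _ _ UU0.
have [l Sl U0l] := cluster U0 UU0 infU0.
exists l => // h; apply: cvg_ultra => U UU infU.
have UP := @ultra_proper _ _ UU.
have [l' Sl' Ul'] := cluster U UU infU.
have /cvg_ex[c xc] := half_sqdist_cvg_dot x l l' (cvgS l Sl) (cvgS l' Sl').
have Xc := time_average_cvg_dot hdot x (l - l') c acx xc.
have lc : dot l (l - l') = c.
  apply: (cvg_unique _ (U0l (l - l'))) => //.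
  by move=> P /Xc; exact: infU0.
have l'c : dot l' (l - l') = c.
  apply: (cvg_unique _ (Ul' (l - l'))) => //.
  by move=> P /Xc; exact: infU.
have -> : l = l'.
  apply/eqP; rewrite -subr_eq0; apply/eqP/(dot_eq0 hdot).
  by rewrite dotBl lc l'c subrr.
exact: Ul'.
Unshelve. all: by end_near. Qed.

End Ergodic.

Theorem theorem2p2 (R : realType) (H : completeNormedModType R)
    (dot : {dot H for idfun}) (hdot : inner_norm dot)
    (A B : operator H)
    (hA : maximal_monotone dot A) (hB : maximal_monotone dot B)
    (hC : zeros B !=set0)
    (hS : zeros (op_add A (normal_cone dot (zeros B))) !=set0)
    (hAN : maximal_monotone dot (op_add A (normal_cone dot (zeros B))))
    (beta : R -> R)
    (hbeta : forall t : R, 0 <= t -> 0 < beta t)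
    (hAB : forall t : R, 0 <= t ->
       maximal_monotone dot (op_add A (op_scale (beta t) B)))
    (hint : forall z q : H, zeros B z -> normal_cone dot (zeros B) z q ->
       (\int[@lebesgue_measure R]_(t in `[0%R, +oo[%classic)
          ((beta t)%:E * brezis_haraux dot B z ((beta t)^-1 *: q)) < +oo)%E)
    (x : R -> H) (hx : strong_global_solution A B beta x) :
  exists xinf : H,
    zeros (op_add A (normal_cone dot (zeros B))) xinf /\
    weakly_cvg dot (pinfty_nbhs R) (time_average x) xinf.
Proof.
have acx := hx.1.
have energyP u w : op_add A (normal_cone dot (zeros B)) u w ->
    exists psi : R -> R,
    [/\ forall t, 0 <= psi t,
        (@lebesgue_measure R).-integrable setT (EFin \o psi) &
        forall s t, 0 <= s -> s <= t ->
        energy dot x u w t - energy dot x u w s <=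
        \int[@lebesgue_measure R]_(r in `]-oo, t]) psi r -
        \int[@lebesgue_measure R]_(r in `]-oo, s]) psi r].
  move=> [a Aua [q Nuq <-]].
  apply: (energy_increments hdot A B beta x u a q hA.1 hbeta) => //.
  - exact: Nuq.1.
  - exact: hint Nuq.1 Nuq.
have half_sqdist_cvg u : zeros (op_add A (normal_cone dot (zeros B))) u ->
    cvg (half_sqdist dot x u t @[t --> +oo]).
  move=> /energyP [psi [psi0 ipsi inc]].
  rewrite energy0 in inc.
  apply: (cvgy_of_bounded_increments _ psi) => // t _.
  exact: half_sqdist_ge0.
have [M xM] : exists M, forall t, 0 <= t -> `|x t| <= M.
  have [u /energyP [psi [psi0 ipsi inc]]] := hS.
  have [C xC] := energy_bounded x u 0 psi psi0 ipsi inc.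
  rewrite energy0 in xC.
  (* [y <= 1 + y ^+ 2] for [y = `|x t - u|] *)
  exists (1 + 2 * C + `|u|) => t t0.
  rewrite -[x t](subrK u); apply: le_trans (ler_normD _ _) _; rewrite lerD2r.
  have := xC t t0; rewrite /half_sqdist hdot.
  by have := sqr_ge0 (`|x t - u| - 1); have := normr_ge0 (x t - u); nra.
have [|l Sl Xl] := opial_time_average hdot
  (zeros (op_add A (normal_cone dot (zeros B)))) x M acx xM half_sqdist_cvg _.
  move=> U l UP infU Ul; apply: (weak_limit_zero _ _ _ U hAN infU Ul).
  move=> u w /energyP [psi [psi0 ipsi inc]].
  have [C xC] := energy_bounded x u w psi psi0 ipsi inc.
  exists C => t t0.
  rewrite (dot_time_average_sub hdot)// mulrC ler_pM2r ?invr_gt0//.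
  apply: le_trans (xC t (ltW t0)); rewrite /energy lerDr.
  exact: half_sqdist_ge0.
by exists l.
Qed.
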